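(* Let $\varphi$ be analytic with positive real part in $\mathbb{D}$, with $\varphi(0)=1$, $\varphi'(0)>0$, $\varphi(\mathbb{D})$ symmetric with respect to the real axis, and Taylor expansion $\varphi(z)=1+B_1z+B_2z^2+B_3z^3+\cdots$ (so $B_1>0$). If $f(z)=z+\sum_{n=2}^{\infty}a_nz^n$ belongs to the class $\mathcal{CV}_{\sigma}(\varphi)$, then $$|a_2|\le\frac{B_1\sqrt{B_1}}{\sqrt{2|B_1^2+2B_1-2B_2|}}\qquad\text{and}\qquad |a_3|\le\frac12\left(B_1+|B_2-B_1|\right).$$
   Context: $\mathbb{D}=\{z\in\mathbb{C}:|z|<1\}$. $\mathcal{A}$ is the class of analytic functions $f$ on $\mathbb{D}$ with $f(0)=0$ and $f'(0)=1$. A function is univalent if it is analytic and injective. A function $f\in\mathcal{A}$ is bi-univalent if both $f$ and its inverse $f^{-1}$ are univalent in $\mathbb{D}$; that is, $f$ is univalent in $\mathbb{D}$ and the inverse of $f$, defined near $0$, extends to a univalent function on $\mathbb{D}$, still denoted $g=f^{-1}$. The class of bi-univalent functions is $\sigma$. An analytic function $F$ on $\mathbb{D}$ is subordinate to an analytic function $G$ on $\mathbb{D}$, written $F\prec G$, if there is an analytic $w:\mathbb{D}\to\mathbb{D}$ with $w(0)=0$ and $F(z)=G(w(z))$ for all $z\in\mathbb{D}$. A function $f\in\sigma$ is in $\mathcal{CV}_{\sigma}(\varphi)$ (bi-convex of Ma-Minda type) if $$1+\frac{zf''(z)}{f'(z)}\prec\varphi(z)\quad\text{and}\quad 1+\frac{wg''(w)}{g'(w)}\prec\varphi(w),\qquad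 g=f^{-1}.$$ Convention: a bound whose denominator vanishes is regarded as $+\infty$ (no assertion). *)

(* Defs.v *)
From Stdlib Require Export Reals.
From Coquelicot Require Export Coquelicot.

Open Scope R_scope.

(* Functions on the unit disk are total functions [C -> C] of which only the
   values on the disk matter. *)
Definition in_disk (z : C) : Prop := Cmod z < 1.

Definition C_pseries (a : nat -> C) (x l : C) : Prop :=
  is_pseries (K := C_AbsRing) (V := C_NormedModule) a x l.

Definition analytic_at (f : C -> C) (z0 : C) : Prop :=
  exists (r : R) (a : nat -> C), 0 < r /\
    forall z : C, Cmod (z - z0) < r -> C_pseries a (z - z0)%C (f z).

Definition analytic (f : C -> C) : Prop :=
  forall z0 : C, in_disk z0 -> analytic_at f z0.

Definition taylor (f : C -> C) (a : nat -> C) : Prop :=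
  forall z : C, in_disk z -> C_pseries a z (f z).

Definition univalent (f : C -> C) : Prop :=
  analytic f /\
  forall z1 z2 : C, in_disk z1 -> in_disk z2 -> f z1 = f z2 -> z1 = z2.

(* [C_derive] is a limit of difference quotients along the real direction; it
   is the complex derivative here because it is only used on analytic
   functions, inside the disk. *)
Definition class_A (f : C -> C) : Prop :=
  analytic f /\ f 0%C = 0%C /\ C_derive f 0%C = 1%C.

(* [g] agrees near 0 with the inverse of the injective function [f] on the
   disk: for w near 0, [g w] is the unique point of the disk sent to w.  *)
Definition local_inverse (f g : C -> C) : Prop :=
  exists r : R, 0 < r /\
    forall w : C, Cmod w < r -> in_disk (g w) /\ f (g w) = w.

(* [f] is bi-univalent, and [g] is the univalent extension of its inverse to
   the disk (its values there are determined by [f]). *)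
Definition bi_univalent_with_inverse (f g : C -> C) : Prop :=
  class_A f /\ univalent f /\ univalent g /\ local_inverse f g.

Definition subordinate (F G : C -> C) : Prop :=
  analytic F /\ analytic G /\
  exists w : C -> C,
    analytic w /\ (forall z : C, in_disk z -> in_disk (w z)) /\ w 0%C = 0%C /\
    forall z : C, in_disk z -> F z = G (w z).

(* 1 + z f''(z) / f'(z); for a univalent [f] the denominator does not vanish
   on the disk. *)
Definition convexity_quotient (f : C -> C) (z : C) : C :=
  (1 + z * C_derive (C_derive f) z / C_derive f z)%C.

Definition class_CV_sigma (phi f : C -> C) : Prop :=
  exists g : C -> C,
    bi_univalent_with_inverse f g /\
    subordinate (convexity_quotient f) phi /\
    subordinate (convexity_quotient g) phi.

(* The image of the disk is stable under complex conjugation; this does not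
   make the Taylor coefficients real, since [phi] need not be injective. *)
Definition image_symmetric (phi : C -> C) : Prop :=
  forall z : C, in_disk z ->
    exists z' : C, in_disk z' /\ phi z' = Cconj (phi z).

(* Main.v *)
Require Import Defs.
From Stdlib Require Import Lra Classical ClassicalEpsilon.

(** Comparing Taylor coefficients up to order two in
    [1 + z f''/f' = phi (c z)] and [1 + w g''/g' = phi (d w)], where
    [c z = c1 z + c2 z^2 + ...] and [d w = d1 w + d2 w^2 + ...] are the two
    Schwarz functions and [g = w - a2 w^2 + (2 a2^2 - a3) w^3 + ...] is the
    inverse of [f], gives
    [2 a2 = B1 c1],  [6 a3 - 4 a2^2 = B1 c2 + B2 c1^2],
    [- 2 a2 = B1 d1],  [8 a2^2 - 6 a3 = B1 d2 + B2 d1^2].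
    Hence [d1 = - c1], and elimination yields
    [(4 B1^2 - 8 B2) a2^2 = B1^3 (c2 + d2)] and
    [6 a3 = B1 (2 c2 + d2) + 3 B2 c1^2].  Both bounds then follow from the sharp
    estimate [|c2| <= 1 - |c1|^2] for Schwarz functions, used for [c] and for [d];
    see [CV_sigma_coefficient_relations] and [coefficient_bounds].

    The sharp estimate ([second_coeff_bound]) comes from the maximum principle
    for real parts on a disk of radius [r < 1], applied to one well chosen
    function.  Take a unimodular [u] with [u c2 = |c2|] and put
    [kap = conj (u c1)], [q = 1 + kap z].  The real part of [u w q^2 / z^2] is at
    most [|q|^2 / r^2] on the circle [|z| = r].  The pole part [u c1 / z] has on
    that circle the same real part as the polynomial [kap z / r^2], and [|q|^2]
    is there a constant plus twice the real part of [kap z]; so, after correction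
    by a linear term, the boundary inequality bounds the real part of a function
    without pole by the constant [1/r^2 + |c1|^2].  Its value at 0 is
    [2 |c1|^2 + |c2|], and [r] tends to 1.

    Analyticity is given by local power series only.  All that the maximum
    principle and the comparison of coefficients use of it is the Taylor expansion
    of order three with a remainder [O(t^4)], called a jet below.  Jets are closed under sums, products, inverses and composition;
    they determine their coefficients; and they are enough for the maximum
    principle, because averaging a jet over the directions [t], [it], [-t], [-it]
    cancels the terms of degree 1, 2 and 3 ([no_interior_max]).  The derivatives
    of [f] and [g] are obtained from termwise differentiation of complex power
    series ([C_pseries_derive]). *)

(** * Complex power series and their derivatives *)

Lemma Cmod_triangle_minus (x y : C) : Cmod (x - y) <= Cmod x + Cmod y.
Proof. unfold Cminus. rewrite <- (Cmod_opp y). apply Cmod_triangle. Qed.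

Lemma series_norm_le (u : nat -> C) (v : nat -> R) (l : C) (s : R) :
  (forall n, Cmod (u n) <= v n) ->
  is_series (K := C_AbsRing) (V := C_NormedModule) u l ->
  is_series v s -> Cmod l <= s.
Proof.
intros huv hu hv.
assert (hl : is_lim_seq (fun n => Cmod (sum_n (G := C_NormedModule) u n)) (Cmod l)).
{ apply (filterlim_comp _ _ _ (sum_n (G := C_NormedModule) u) Cmod _ _ _ hu).
  exact (filterlim_norm (K := C_AbsRing) (V := C_NormedModule) l). }
refine (is_lim_seq_le _ (sum_n v) _ (Finite s) _ hl hv).
intros n; induction n as [|n IH].
- rewrite !sum_O. apply huv.
- rewrite !sum_Sn. eapply Rle_trans; [apply Cmod_triangle|].
  apply Rplus_le_compat; [exact IH|apply huv].
Qed.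

Lemma C_series_tail (u : nat -> C) (l : C) :
  u 0%nat = 0%C ->
  is_series (K := C_AbsRing) (V := C_NormedModule) u l ->
  is_series (K := C_AbsRing) (V := C_NormedModule) (fun n => u (S n)) l.
Proof.
intros h0 h. apply is_series_incr_1. rewrite h0.
change (is_series (K := C_AbsRing) (V := C_NormedModule) u (l + 0)%C).
rewrite Cplus_0_r. exact h.
Qed.

Lemma C_pseries_series (a : nat -> C) (x l : C) :
  C_pseries a x l <->
  is_series (K := C_AbsRing) (V := C_NormedModule) (fun n => Cmult (x ^ n) (a n)) l.
Proof.
unfold C_pseries, is_pseries.
split; apply is_series_ext; intros n; reflexivity.
Qed.

Lemma C_pseries_bounded (a : nat -> C) (x l : C) :
  C_pseries a x l -> exists M : R, forall n, Rabs (Cmod (a n) * Cmod x ^ n) <= M.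
Proof.
intros h%C_pseries_series.
destruct (filterlim_bounded (K := C_AbsRing) (V := C_NormedModule)
   (sum_n (G := C_NormedModule) (fun n => Cmult (x ^ n) (a n)))) as [M hM].
{ exists l. exact h. }
exists (M + M). intros n.
assert (hM' : forall n, Cmod (sum_n (G := C_NormedModule) (fun n => Cmult (x ^ n) (a n)) n) <= M).
{ exact hM. }
rewrite <- Cmod_pow, <- Cmod_mult, Rabs_pos_eq by apply Cmod_ge_0.
rewrite Cmult_comm.
destruct n as [|n].
- specialize (hM' 0%nat). rewrite sum_O in hM'. pose proof (Cmod_ge_0 (x ^ 0 * a 0%nat)%C). lra.
- pose proof (hM' n) as h1. pose proof (hM' (S n)) as h2. rewrite sum_Sn in h2.
  set (s := sum_n _ n) in *.
  replace (x ^ S n * a (S n))%C with ((s + x ^ S n * a (S n)) - s)%C by ring.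
  eapply Rle_trans; [apply Cmod_triangle_minus|].
  apply Rplus_le_compat; [exact h2|exact h1].
Qed.

(** Convergence of a complex series is transferred to the real series of the
    moduli, whose radius of convergence is that of its derived series; this
    supplies all absolute convergence needed for termwise differentiation. *)
Lemma C_pseries_CV_radius (a : nat -> C) (f : C -> C) (r : R) :
  (forall z : C, Cmod z < r -> C_pseries a z (f z)) ->
  Rbar_le r (CV_radius (fun n => Cmod (a n))).
Proof.
intros h.
destruct (Rle_lt_dec r 0) as [hr|hr].
{ apply Rbar_le_trans with 0; [exact hr|apply CV_radius_ge_0]. }
destruct (CV_radius_bounded (fun n => Cmod (a n))) as [hub _].
assert (hlt : forall s, 0 <= s < r -> Rbar_le s (CV_radius (fun n => Cmod (a n)))).
{ intros s hs. apply hub.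
  destruct (C_pseries_bounded a s (f s)) as [M hM].
  - apply h. rewrite Cmod_R, Rabs_pos_eq; lra.
  - exists M. intros n. rewrite Cmod_R, (Rabs_pos_eq s) in hM by lra. apply hM. }
destruct (CV_radius (fun n => Cmod (a n))) as [c| |]; simpl in *; auto.
- apply Rnot_lt_le. intros hc.
  specialize (hlt ((Rmax c 0 + r) / 2)).
  pose proof (Rmax_l c 0); pose proof (Rmax_r c 0).
  assert (Rmax c 0 < r) by (apply Rmax_lub_lt; lra).
  assert ((Rmax c 0 + r) / 2 <= c) by (apply hlt; lra). lra.
- apply (hlt 0). lra.
Qed.

Definition C_PS_derive (a : nat -> C) (n : nat) : C := (INR (S n) * a (S n))%C.

(** Second-order Taylor remainder of [y ^ S n] at [x]; see [pow_remainderE].  The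
    recursion makes the factor [(y - x) ^ 2] explicit. *)
Fixpoint pow_remainder (x y : C) (n : nat) : C :=
  match n with
  | O => 0%C
  | S m => (y * pow_remainder x y m + INR (S m) * (y - x) ^ 2 * x ^ m)%C
  end.

Lemma pow_remainderE (x y : C) n :
  (y ^ S n - x ^ S n - (y - x) * (INR (S n) * x ^ n) = pow_remainder x y n)%C.
Proof.
induction n as [|n IH].
- simpl. ring.
- cbn [pow_remainder]. rewrite <- IH.
  rewrite (S_INR (S n)), RtoC_plus. generalize (RtoC (INR (S n))). intros c.
  simpl. ring.
Qed.

(** The factor next to [Cmod (y - x) ^ 2] is the weight of a second formal
    derivative, so the remainders of all terms of a power series add up to at
    most [Cmod (y - x) ^ 2] times the second derivative of the series of moduli. *)
Lemma pow_remainder_le (x y : C) (t : R) n :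
  Cmod x <= t -> Cmod y <= t ->
  Cmod (pow_remainder x y (S n)) <= Cmod (y - x) ^ 2 * (INR (S n) * INR (S (S n)) * t ^ n).
Proof.
intros hx hy. pose proof (Cmod_ge_0 x) as hx0. pose proof (Cmod_ge_0 y) as hy0.
induction n as [|n IH].
- replace (pow_remainder x y 1) with ((y - x) ^ 2)%C by (simpl; ring).
  rewrite Cmod_pow. simpl (INR 1). simpl (INR 2). pose proof (pow2_ge_0 (Cmod (y - x))).
  simpl (t ^ 0). nra.
- change (pow_remainder x y (S (S n)))
    with (y * pow_remainder x y (S n) + INR (S (S n)) * (y - x) ^ 2 * x ^ (S n))%C.
  eapply Rle_trans; [apply Cmod_triangle|].
  rewrite !Cmod_mult, !Cmod_pow, Cmod_R, Rabs_pos_eq by apply pos_INR.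
  assert (h1 : Cmod y * Cmod (pow_remainder x y (S n)) <=
     t * (Cmod (y - x) ^ 2 * (INR (S n) * INR (S (S n)) * t ^ n))).
  { apply Rmult_le_compat; try apply Cmod_ge_0; assumption. }
  assert (h2 : Cmod x ^ S n <= t ^ S n) by (apply pow_incr; lra).
  assert (hh : 0 <= INR (S (S n)) * Cmod (y - x) ^ 2).
  { apply Rmult_le_pos; [apply pos_INR|apply pow2_ge_0]. }
  pose proof (Rmult_le_compat_l _ _ _ hh h2) as h3.
  assert (h4 : 0 <= t ^ S n) by (apply pow_le; lra).
  assert (h5 : INR (S (S (S n))) = INR (S n) + 2) by (rewrite 2!(S_INR (S _)); lra).
  rewrite h5. simpl (t ^ S n) in *.
  pose proof (Rmult_le_pos _ _ hh h4).
  nra.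
Qed.

Lemma ex_C_PS_derive (a : nat -> C) (f : C -> C) (r : R) (z : C) :
  (forall z : C, Cmod z < r -> C_pseries a z (f z)) -> Cmod z < r ->
  exists l, C_pseries (C_PS_derive a) z l.
Proof.
intros h hz.
destruct (ex_series_le (K := C_AbsRing) (V := C_CompleteNormedModule)
  (fun n => Cmult (z ^ n) (C_PS_derive a n))
  (fun n => Rabs (PS_derive (fun n => Cmod (a n)) n * Cmod z ^ n))) as [l hl].
- intros n.
  change (norm (Cmult (z ^ n) (C_PS_derive a n))) with (Cmod (Cmult (z ^ n) (C_PS_derive a n))).
  apply Req_le. unfold C_PS_derive, PS_derive.
  rewrite !Cmod_mult, Cmod_pow, Cmod_R, !Rabs_mult.
  rewrite (Rabs_pos_eq (Cmod (a _))) by apply Cmod_ge_0.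
  rewrite (Rabs_pos_eq (Cmod z ^ n)) by apply pow_le, Cmod_ge_0. ring.
- apply CV_disk_inside. rewrite CV_radius_derive, Rabs_pos_eq by apply Cmod_ge_0.
  eapply Rbar_lt_le_trans; [|exact (C_pseries_CV_radius a f r h)]. exact hz.
- exists l. apply C_pseries_series. exact hl.
Qed.

(** Differentiability with a quadratic error term, uniform in [y]: the error is
    the sum of the remainders of the monomials, dominated by the second derived
    series of the moduli at a radius [t] between [Cmod z] and [r]. *)
Lemma C_pseries_deriv_estimate (a : nat -> C) (f : C -> C) (r : R) (z l : C) :
  (forall z : C, Cmod z < r -> C_pseries a z (f z)) -> Cmod z < r ->
  C_pseries (C_PS_derive a) z l ->
  exists M d : R, 0 < d /\
   forall y, Cmod (y - z) < d -> Cmod y < r /\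
     Cmod (f y - f z - (y - z) * l) <= M * Cmod (y - z) ^ 2.
Proof.
intros h hz hl.
set (t := (Cmod z + r) / 2).
pose proof (Cmod_ge_0 z) as hz0.
set (v := PS_derive (PS_derive (fun n => Cmod (a n)))).
assert (hv : ex_series (fun n => Rabs (v n * t ^ n))).
{ apply CV_disk_inside. unfold v. rewrite !CV_radius_derive, Rabs_pos_eq by (unfold t; lra).
  eapply Rbar_lt_le_trans; [|exact (C_pseries_CV_radius a f r h)]. simpl. unfold t; lra. }
destruct hv as [M hM].
exists M, (t - Cmod z). split; [unfold t; lra|].
intros y hy.
assert (hyt : Cmod y <= t).
{ replace y with (y - z + z)%C by ring. eapply Rle_trans; [apply Cmod_triangle|lra]. }
assert (hyr : Cmod y < r) by (unfold t in hyt; lra).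
split; [exact hyr|].
pose proof (proj1 (C_pseries_series _ _ _) (h y hyr)) as hsy.
pose proof (proj1 (C_pseries_series _ _ _) (h z hz)) as hsz.
pose proof (proj1 (C_pseries_series _ _ _) hl) as hsl.
assert (h2 : is_series (K := C_AbsRing) (V := C_NormedModule)
  (fun n => y ^ S n * a (S n) - z ^ S n * a (S n))%C (f y - f z)%C).
{ apply (C_series_tail (fun n => y ^ n * a n - z ^ n * a n)%C); [simpl; ring|].
  exact (is_series_minus _ _ _ _ hsy hsz). }
pose proof (is_series_minus _ _ _ _ h2 (is_series_scal (y - z)%C _ _ hsl)) as h3.
assert (h5 : is_series (K := C_AbsRing) (V := C_NormedModule)
  (fun n => a (S (S n)) * pow_remainder z y (S n))%C (f y - f z - (y - z) * l)%C).
{ apply (C_series_tail (fun n => a (S n) * pow_remainder z y n)%C); [simpl; ring|].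
  eapply is_series_ext; [|exact h3]. intros n. rewrite <- pow_remainderE.
  change (y ^ S n * a (S n) - z ^ S n * a (S n) - (y - z) * (z ^ n * (INR (S n) * a (S n)))
    = a (S n) * (y ^ S n - z ^ S n - (y - z) * (INR (S n) * z ^ n)))%C. ring. }
rewrite (Rmult_comm M).
apply (series_norm_le _ _ _ _) with (2 := h5)
  (3 := is_series_scal (K := R_AbsRing) (V := R_NormedModule) (Cmod (y - z) ^ 2) _ _ hM).
intros n. rewrite Cmod_mult.
assert (hzt : Cmod z <= t) by (unfold t; lra).
pose proof (pow_remainder_le z y t n hzt hyt) as h6.
pose proof (Rmult_le_compat_l _ _ _ (Cmod_ge_0 (a (S (S n)))) h6) as h7.
eapply Rle_trans; [exact h7|].
match goal with |- ?L <= _ => change (L <= Cmod (y - z) ^ 2 * Rabs (v n * t ^ n)) end.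
eapply Rle_trans; [|apply Rmult_le_compat_l; [apply pow2_ge_0|apply Rle_abs]].
unfold v, PS_derive. apply Req_le. ring.
Qed.

Lemma C_derive_of_estimate (f : C -> C) (z l : C) (M d : R) :
  0 < d ->
  (forall y, Cmod (y - z) < d -> Cmod (f y - f z - (y - z) * l) <= M * Cmod (y - z) ^ 2) ->
  C_derive f z = l.
Proof.
intros hd h. apply is_C_lim_unique.
intros P [e he].
assert (hM : 0 < Rabs M + 1) by (pose proof (Rabs_pos M); lra).
assert (hp : 0 < Rmin d (e / (Rabs M + 1)) / 2).
{ apply Rdiv_lt_0_compat; [|lra]. apply Rmin_glb_lt; [lra|].
  apply Rdiv_lt_0_compat; [apply cond_pos|lra]. }
exists (mkposreal _ hp). intros y hy hyz.
apply he, C_NormedModule_mixin_compat1.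
assert (hy' : Cmod (y - z) < Rmin d (e / (Rabs M + 1))).
{ eapply Rlt_trans; [apply (C_NormedModule_mixin_compat2 z y _ hy)|]. simpl.
  assert (sqrt 2 < 2).
  { rewrite <- (sqrt_square 2) at 2 by lra. apply sqrt_lt_1; lra. }
  assert (0 < Rmin d (e / (Rabs M + 1))) by lra. nra. }
assert (hnz : (y - z <> 0)%C).
{ intros h0. apply hyz. replace y with (y - z + z)%C by ring. rewrite h0. exact (Cplus_0_l z). }
pose proof (proj1 (Cmod_gt_0 _) hnz) as hpos.
change (Cmod ((f y - f z) / (y - z) - l)%C < e).
replace ((f y - f z) / (y - z) - l)%C with ((f y - f z - (y - z) * l) / (y - z))%C
  by (field; exact hnz).
rewrite Cmod_div by exact hnz.
apply Rlt_div_l; [exact hpos|].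
eapply Rle_lt_trans; [apply h; eapply Rlt_le_trans; [exact hy'|apply Rmin_l]|].
assert (h1 : Cmod (y - z) * (Rabs M + 1) < e).
{ apply Rlt_div_r; [exact hM|]. eapply Rlt_le_trans; [exact hy'|apply Rmin_r]. }
pose proof (Rle_abs M). nra.
Qed.

Lemma C_pseries_derive (a : nat -> C) (f : C -> C) (r : R) :
  (forall z : C, Cmod z < r -> C_pseries a z (f z)) ->
  forall z : C, Cmod z < r -> C_pseries (C_PS_derive a) z (C_derive f z).
Proof.
intros h z hz.
destruct (ex_C_PS_derive a f r z h hz) as [l hl].
destruct (C_pseries_deriv_estimate a f r z l h hz hl) as [M [d [hd he]]].
rewrite (C_derive_of_estimate f z l M d hd); [exact hl|].
intros y hy. apply he, hy.
Qed.

Lemma C_pseries_unique (a : nat -> C) (x l l' : C) :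
  C_pseries a x l -> C_pseries a x l' -> l = l'.
Proof.
intros h h'.
exact (filterlim_locally_unique (K := C_AbsRing) (V := C_NormedModule) _ _ _ h h').
Qed.

Lemma C_pseries_at_0 (a : nat -> C) (l : C) : C_pseries a 0%C l -> l = a 0%nat.
Proof.
intros h. apply (C_pseries_unique a 0%C); [exact h|].
apply (is_pseries_0 (K := C_AbsRing) (V := C_NormedModule)).
Qed.

(** Division by [z]: the quotient has a removable singularity at 0, where the
    shifted series gives its value. *)
Lemma C_pseries_shift (a : nat -> C) (f : C -> C) (r : R) :
  (forall z : C, Cmod z < r -> C_pseries a z (f z)) ->
  exists f1 : C -> C,
    (forall z : C, Cmod z < r -> C_pseries (fun n => a (S n)) z (f1 z)) /\
    (forall z : C, Cmod z < r -> f z = (a 0%nat + z * f1 z)%C).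
Proof.
intros h.
exists (fun z : C => if excluded_middle_informative (z = 0%C) then a 1%nat
                 else ((f z - a 0%nat) / z)%C).
split; intros z hz; destruct (excluded_middle_informative (z = 0%C)) as [hz0|hz0].
- rewrite hz0.
  apply (is_pseries_0 (K := C_AbsRing) (V := C_NormedModule) (fun n => a (S n))).
- replace ((f z - a 0%nat) / z)%C with (/ z * (f z - a 0%nat))%C by (field; exact hz0).
  refine (is_pseries_decr_1 (K := C_AbsRing) (V := C_NormedModule) a z (/ z)%C (f z) _ (h z hz)).
  exact (Cinv_l z hz0).
- rewrite hz0 in *. rewrite (C_pseries_at_0 _ _ (h _ hz)). ring.
- field. exact hz0.
Qed.

(** * Jets of order three *)

Lemma Cminus_eq (x y : C) : (x - y = 0)%C -> x = y.
Proof. intros h. replace x with (x - y + y)%C by ring. rewrite h. ring. Qed.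

Definition near0 (P : C -> Prop) : Prop :=
  exists d : R, 0 < d /\ forall t : C, Cmod t < d -> P t.

Lemma near0_and (P Q : C -> Prop) : near0 P -> near0 Q -> near0 (fun t => P t /\ Q t).
Proof.
intros [d [hd hP]] [e [he hQ]]. exists (Rmin d e). split; [now apply Rmin_glb_lt|].
intros t ht. split; [apply hP|apply hQ]; eapply Rlt_le_trans; try exact ht;
  [apply Rmin_l|apply Rmin_r].
Qed.

Lemma near0_impl (P Q : C -> Prop) : (forall t, P t -> Q t) -> near0 P -> near0 Q.
Proof. intros h [d [hd hP]]. exists d. split; auto. Qed.

Lemma near0_at_0 (P : C -> Prop) : near0 P -> P 0%C.
Proof. intros [d [hd hP]]. apply hP. now rewrite Cmod_0. Qed.

Definition loc_bounded (k : C -> C) : Prop :=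
  exists M : R, near0 (fun t => Cmod (k t) <= M).

Lemma loc_bounded_const (c : C) : loc_bounded (fun _ => c).
Proof. exists (Cmod c), 1. split; [lra|]. intros; lra. Qed.

Lemma loc_bounded_id : loc_bounded (fun t => t).
Proof. exists 1, 1. split; [lra|]. intros; lra. Qed.

Lemma loc_bounded_plus (k l : C -> C) :
  loc_bounded k -> loc_bounded l -> loc_bounded (fun t => k t + l t)%C.
Proof.
intros [M hM] [N hN]. exists (M + N).
apply near0_impl with (2 := near0_and _ _ hM hN). intros t [h1 h2].
eapply Rle_trans; [apply Cmod_triangle|lra].
Qed.

Lemma loc_bounded_mult (k l : C -> C) :
  loc_bounded k -> loc_bounded l -> loc_bounded (fun t => k t * l t)%C.
Proof.
intros [M hM] [N hN]. exists (M * N).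
apply near0_impl with (2 := near0_and _ _ hM hN). intros t [h1 h2].
rewrite Cmod_mult. apply Rmult_le_compat; auto using Cmod_ge_0.
Qed.

Lemma loc_bounded_near (k l : C -> C) :
  near0 (fun t => k t = l t) -> loc_bounded l -> loc_bounded k.
Proof.
intros h [M hM]. exists M. apply near0_impl with (2 := near0_and _ _ h hM).
intros t [-> hl]; exact hl.
Qed.

Ltac loc_bounded :=
  lazymatch goal with
  | |- loc_bounded (fun t => Cplus (@?k t) (@?l t)) =>
      apply (loc_bounded_plus k l); loc_bounded
  | |- loc_bounded (fun t => Cmult (@?k t) (@?l t)) =>
      apply (loc_bounded_mult k l); loc_bounded
  | |- loc_bounded (fun t => t) => apply loc_bounded_id
  | |- loc_bounded (fun _ => ?c) => first [apply loc_bounded_const | assumption]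
  | |- _ => assumption
  end.

(** The remainder is kept in factored form, so that algebra on jets is a ring
    identity followed by the closure of [loc_bounded] under ring operations. *)
Definition jet (g : C -> C) (c0 c1 c2 c3 : C) : Prop :=
  exists k : C -> C, loc_bounded k /\
    near0 (fun t => g t = c0 + t * (c1 + t * (c2 + t * (c3 + t * k t))))%C.

Lemma jet_at_0 g c0 c1 c2 c3 : jet g c0 c1 c2 c3 -> g 0%C = c0.
Proof. intros [k [hk h]]. rewrite (near0_at_0 _ h). ring. Qed.

Lemma jet_near g h c0 c1 c2 c3 :
  near0 (fun t => g t = h t) -> jet h c0 c1 c2 c3 -> jet g c0 c1 c2 c3.
Proof.
intros e [k [hk hh]]. exists k. split; [exact hk|].
apply near0_impl with (2 := near0_and _ _ e hh). intros t [-> ht]; exact ht.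
Qed.

Lemma jet_ext g h c0 c1 c2 c3 :
  (forall t, g t = h t) -> jet h c0 c1 c2 c3 -> jet g c0 c1 c2 c3.
Proof. intros e. apply jet_near. exists 1. split; [lra|auto]. Qed.

Lemma jet_const c : jet (fun _ => c) c 0 0 0.
Proof.
exists (fun _ => 0%C). split; [loc_bounded|]. exists 1. split; [lra|]. intros t _. ring.
Qed.

Lemma jet_id : jet (fun t => t) 0 1 0 0.
Proof.
exists (fun _ => 0%C). split; [loc_bounded|]. exists 1. split; [lra|]. intros t _. ring.
Qed.

Lemma jet_plus g h c0 c1 c2 c3 d0 d1 d2 d3 :
  jet g c0 c1 c2 c3 -> jet h d0 d1 d2 d3 ->
  jet (fun t => g t + h t)%C (c0 + d0) (c1 + d1) (c2 + d2) (c3 + d3).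
Proof.
intros [k [hk hg]] [l [hl hh]].
exists (fun t => k t + l t)%C. split; [loc_bounded|].
apply near0_impl with (2 := near0_and _ _ hg hh). intros t [-> ->]. ring.
Qed.

Lemma jet_mult g h c0 c1 c2 c3 d0 d1 d2 d3 :
  jet g c0 c1 c2 c3 -> jet h d0 d1 d2 d3 ->
  jet (fun t => g t * h t)%C (c0 * d0) (c0 * d1 + c1 * d0)
    (c0 * d2 + c1 * d1 + c2 * d0) (c0 * d3 + c1 * d2 + c2 * d1 + c3 * d0).
Proof.
intros [k [hk hg]] [l [hl hh]].
exists (fun t => k t * (d0 + t * (d1 + t * (d2 + t * d3)))
   + (c0 + t * (c1 + t * (c2 + t * c3))) * l t + t * t * t * t * (k t * l t)
   + (c1 * d3 + c2 * d2 + c3 * d1) + t * (c2 * d3 + c3 * d2) + t * t * (c3 * d3))%C.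
split; [loc_bounded|].
apply near0_impl with (2 := near0_and _ _ hg hh). intros t [-> ->]. ring.
Qed.

(** The point [t = 0] is excluded so that the identity survives a division by [t]. *)
Lemma coeff_zero (c : C) (k : C -> C) :
  loc_bounded k -> near0 (fun t => t <> 0%C -> c + t * k t = 0)%C -> c = 0%C.
Proof.
intros [M hM] h. destruct (near0_and _ _ hM h) as [d [hd hh]].
apply Cmod_eq_0. destruct (Rle_lt_or_eq_dec _ _ (Cmod_ge_0 c)) as [hc|hc]; [|auto].
exfalso.
set (s := Rmin (d / 2) (Cmod c / (2 * (Rabs M + 1)))).
pose proof (Rabs_pos M).
assert (hs : 0 < s).
{ apply Rmin_glb_lt; [lra|]. apply Rdiv_lt_0_compat; lra. }
destruct (hh (RtoC s)) as [hk he].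
{ rewrite Cmod_R, Rabs_pos_eq by lra. pose proof (Rmin_l (d / 2) (Cmod c / (2 * (Rabs M + 1)))).
  unfold s. lra. }
assert (hne : RtoC s <> 0%C) by (intros h0; apply RtoC_inj in h0; lra).
specialize (he hne).
assert (hc2 : c = (- (s * k s))%C).
{ replace c with (c + s * k s - s * k s)%C by ring. rewrite he. ring. }
assert (hb : s * (2 * (Rabs M + 1)) <= Cmod c).
{ apply Rle_div_r; [lra|]. apply Rmin_r. }
apply (f_equal Cmod) in hc2. rewrite Cmod_opp, Cmod_mult, Cmod_R, (Rabs_pos_eq s) in hc2 by lra.
pose proof (Rle_abs M). nra.
Qed.

Lemma coeff_step (c : C) (k : C -> C) :
  loc_bounded k -> near0 (fun t => t <> 0%C -> c + t * k t = 0)%C ->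
  c = 0%C /\ near0 (fun t => t <> 0%C -> k t = 0)%C.
Proof.
intros hk h. pose proof (coeff_zero c k hk h) as hc. split; [exact hc|].
apply near0_impl with (2 := h). intros t ht ht0. specialize (ht ht0).
rewrite hc in ht. rewrite Cplus_0_l in ht.
replace (k t) with (t * k t / t)%C by (field; exact ht0). rewrite ht. field. exact ht0.
Qed.

(** The difference of the two expansions vanishes identically; its coefficients
    are read off one after the other by letting [t] tend to 0 and dividing by [t]. *)
Lemma jet_unique g c0 c1 c2 c3 d0 d1 d2 d3 :
  jet g c0 c1 c2 c3 -> jet g d0 d1 d2 d3 -> c0 = d0 /\ c1 = d1 /\ c2 = d2 /\ c3 = d3.
Proof.
intros [k [hk hg]] [l [hl hh]].
assert (h : near0 (fun t => t <> 0%C -> (c0 - d0) + t * ((c1 - d1) + t * ((c2 - d2)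
     + t * ((c3 - d3) + t * (k t + - (1) * l t)))) = 0)%C).
{ apply near0_impl with (2 := near0_and _ _ hg hh). intros t [h1 h2] _.
  rewrite h1 in h2.
  match type of h2 with ?x = ?y => transitivity (x - y)%C; [ring|rewrite h2; ring] end. }
apply coeff_step in h as [e0 h]; [|loc_bounded].
apply coeff_step in h as [e1 h]; [|loc_bounded].
apply coeff_step in h as [e2 h]; [|loc_bounded].
apply coeff_step in h as [e3 h]; [|loc_bounded].
repeat split; now apply Cminus_eq.
Qed.

(** [g t] is [t] times a locally bounded function, so for small [t] it stays in
    the domain of the expansion of [f], and [g t ^ 4] is absorbed by the remainder. *)
Lemma jet_comp0 f g c0 c1 c2 c3 d1 d2 d3 :
  jet f c0 c1 c2 c3 -> jet g 0 d1 d2 d3 ->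
  jet (fun t => f (g t)) c0 (c1 * d1) (c1 * d2 + c2 * d1 * d1)
    (c1 * d3 + 2 * c2 * d1 * d2 + c3 * d1 * d1 * d1).
Proof.
intros [k [hk hf]] [l [hl hg]].
set (h := (fun t => d1 + t * (d2 + t * (d3 + t * l t)))%C).
assert (hh : loc_bounded h) by (unfold h; loc_bounded).
assert (hsmall : forall P, near0 P -> near0 (fun t => P (g t))).
{ intros P [e [he hP]]. destruct hh as [M hM].
  destruct (near0_and _ _ hM hg) as [d [hd hd']].
  pose proof (Rabs_pos M). pose proof (Rle_abs M).
  exists (Rmin d (e / (Rabs M + 1))). split.
  { apply Rmin_glb_lt; [lra|]. apply Rdiv_lt_0_compat; lra. }
  intros t ht. apply hP.
  destruct (hd' t) as [h1 h2].
  { eapply Rlt_le_trans; [exact ht|apply Rmin_l]. }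
  assert (ht2 : Cmod t * (Rabs M + 1) < e).
  { apply Rlt_div_r; [lra|]. eapply Rlt_le_trans; [exact ht|apply Rmin_r]. }
  rewrite h2. fold (h t). rewrite Cplus_0_l, Cmod_mult.
  pose proof (Cmod_ge_0 t). nra. }
assert (hkg : loc_bounded (fun t => k (g t))).
{ destruct hk as [M hM]. exists M. apply (hsmall (fun t => Cmod (k t) <= M) hM). }
set (e := (fun t => d2 + t * (d3 + t * l t))%C).
assert (he : loc_bounded e) by (unfold e; loc_bounded).
exists (fun t => c1 * l t + c2 * (2 * d1 * (d3 + t * l t) + e t * e t)
   + c3 * (3 * d1 * d1 * e t + 3 * d1 * t * (e t * e t) + t * t * (e t * e t * e t))
   + h t * h t * h t * h t * k (g t))%C.
split; [loc_bounded|].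
apply near0_impl with (2 := near0_and _ _ hg (hsmall _ hf)). intros t [h1 h2].
rewrite h2. rewrite h1 at 1 2 3 4. unfold h, e. ring.
Qed.

(** Four divisions by [z] peel off the coefficients; the last quotient is again
    a power series, hence differentiable at 0 and bounded near it. *)
Lemma jet_C_pseries (a : nat -> C) (f : C -> C) (r : R) :
  0 < r -> (forall z : C, Cmod z < r -> C_pseries a z (f z)) ->
  jet f (a 0%nat) (a 1%nat) (a 2%nat) (a 3%nat).
Proof.
intros hr h0.
destruct (C_pseries_shift _ _ _ h0) as [f1 [h1 e0]].
destruct (C_pseries_shift _ _ _ h1) as [f2 [h2 e1]].
destruct (C_pseries_shift _ _ _ h2) as [f3 [h3 e2]].
destruct (C_pseries_shift _ _ _ h3) as [f4 [h4 e3]].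
exists f4. split.
- assert (hz : Cmod 0 < r) by (rewrite Cmod_0; exact hr).
  pose proof (C_pseries_derive _ _ _ h4 0%C hz) as hd.
  destruct (C_pseries_deriv_estimate _ _ _ _ _ h4 hz hd) as [M [d [hd0 he]]].
  apply loc_bounded_near with (fun t => f4 0%C + t * C_derive f4 0 + (f4 t - f4 0%C - t * C_derive f4 0))%C.
  { exists 1. split; [lra|]. intros t _. ring. }
  assert (hb : loc_bounded (fun t => f4 t - f4 0%C - t * C_derive f4 0)%C).
  { exists (Rabs M), (Rmin d 1). split; [apply Rmin_glb_lt; lra|].
    intros t ht.
    assert (ht0 : (t - 0)%C = t) by ring.
    assert (htd : Cmod (t - 0) < d).
    { rewrite ht0. eapply Rlt_le_trans; [exact ht|apply Rmin_l]. }
    assert (ht1 : Cmod t < 1) by (eapply Rlt_le_trans; [exact ht|apply Rmin_r]).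
    destruct (he t htd) as [_ hh]. rewrite ht0 in hh.
    eapply Rle_trans; [exact hh|].
    pose proof (Cmod_ge_0 t). pose proof (Rle_abs M). pose proof (Rabs_pos M).
    assert (Cmod t ^ 2 <= 1) by nra. pose proof (pow2_ge_0 (Cmod t)). nra. }
  loc_bounded.
- exists r. split; [exact hr|]. intros t ht.
  rewrite e0, e1, e2, e3 by exact ht. reflexivity.
Qed.

Definition has_jet (f : C -> C) (z0 : C) : Prop :=
  exists c0 c1 c2 c3 : C, jet (fun t => f (z0 + t)%C) c0 c1 c2 c3.

Lemma has_jet_const c z0 : has_jet (fun _ => c) z0.
Proof. exists c, 0%C, 0%C, 0%C. apply jet_const. Qed.

Lemma has_jet_id z0 : has_jet (fun z => z) z0.
Proof.
do 4 eexists. exact (jet_plus _ _ _ _ _ _ _ _ _ _ (jet_const z0) jet_id).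
Qed.

Lemma has_jet_plus f g z0 : has_jet f z0 -> has_jet g z0 -> has_jet (fun z => f z + g z)%C z0.
Proof.
intros (c0 & c1 & c2 & c3 & hf) (d0 & d1 & d2 & d3 & hg).
do 4 eexists. exact (jet_plus _ _ _ _ _ _ _ _ _ _ hf hg).
Qed.

Lemma has_jet_mult f g z0 : has_jet f z0 -> has_jet g z0 -> has_jet (fun z => f z * g z)%C z0.
Proof.
intros (c0 & c1 & c2 & c3 & hf) (d0 & d1 & d2 & d3 & hg).
do 4 eexists. exact (jet_mult _ _ _ _ _ _ _ _ _ _ hf hg).
Qed.

(** Truncated geometric series. *)
Lemma jet_inv (z0 : C) : z0 <> 0%C ->
  jet (fun t : C => / (z0 + t))%C (/ z0) (- (/ z0 * / z0))
    (/ z0 * / z0 * / z0) (- (/ z0 * / z0 * / z0 * / z0)).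
Proof.
intros hz. set (i := (/ z0)%C).
assert (hpos : 0 < Cmod z0) by (apply Cmod_gt_0; exact hz).
assert (hnear : forall t, Cmod t < Cmod z0 / 2 -> Cmod z0 / 2 <= Cmod (z0 + t)).
{ intros t ht. assert (h : Cmod z0 <= Cmod (z0 + t) + Cmod t).
  { replace z0 with (z0 + t - t)%C at 1 by ring. apply Cmod_triangle_minus. }
  lra. }
assert (hne : forall t, Cmod t < Cmod z0 / 2 -> (z0 + t)%C <> 0%C).
{ intros t ht. apply Cmod_gt_0. specialize (hnear t ht). lra. }
assert (hb : loc_bounded (fun t => / (z0 + t))%C).
{ exists (/ (Cmod z0 / 2)), (Cmod z0 / 2). split; [lra|].
  intros t ht. rewrite Cmod_inv by auto. apply Rinv_le_contravar; [lra|auto]. }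
exists (fun t => i * i * i * i * / (z0 + t))%C. split; [loc_bounded|].
exists (Cmod z0 / 2). split; [lra|].
intros t ht. unfold i. field. split; auto.
Qed.

Lemma has_jet_inv (z0 : C) : z0 <> 0%C -> has_jet (fun z : C => / z)%C z0.
Proof. intros hz. do 4 eexists. exact (jet_inv z0 hz). Qed.

Lemma has_jet_near f g z0 :
  near0 (fun t => f (z0 + t)%C = g (z0 + t)%C) -> has_jet g z0 -> has_jet f z0.
Proof.
intros h (c0 & c1 & c2 & c3 & hg). exists c0, c1, c2, c3.
exact (jet_near _ _ _ _ _ _ h hg).
Qed.

Lemma analytic_at_jet f z0 : analytic_at f z0 -> has_jet f z0.
Proof.
intros (r & a & hr & h).
exists (a 0%nat), (a 1%nat), (a 2%nat), (a 3%nat).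
apply jet_C_pseries with r; [exact hr|].
intros t ht. specialize (h (z0 + t)%C).
replace (z0 + t - z0)%C with t in h by ring. auto.
Qed.

(** * The maximum principle for real parts *)

(** Compactness of the closed disk: a property that holds with a local gauge
    around each point holds with one gauge on the whole disk.  The same [d] serves
    as radius of the neighbourhood and as gauge because [P] is inherited by
    smaller gauges. *)
Lemma disk_uniform (r : R) (P : C -> R -> Prop) :
  (forall z d d', P z d -> 0 < d' <= d -> P z d') ->
  (forall p, Cmod p <= r -> exists d, 0 < d /\
     forall z, Cmod z <= r -> Cmod (z - p) < d -> P z d) ->
  exists d, 0 < d /\ forall z, Cmod z <= r -> P z d.
Proof.
intros hmono hloc.
assert (hall : forall p : C, exists d : posreal,
   forall z, Cmod z <= r -> Cmod (z - p) < 2 * d -> P z (2 * d)).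
{ intros p. destruct (Rle_lt_dec (Cmod p) r) as [hp|hp].
  - destruct (hloc p hp) as [d [hd h]].
    assert (hd2 : 0 < d / 2) by lra. exists (mkposreal _ hd2). simpl.
    replace (2 * (d / 2)) with d by field. exact h.
  - assert (hd2 : 0 < (Cmod p - r) / 2) by lra. exists (mkposreal _ hd2). simpl.
    intros z hz h. exfalso.
    assert (Cmod p <= Cmod z + Cmod (z - p)).
    { replace p with (z - (z - p))%C at 1 by ring. apply Cmod_triangle_minus. }
    lra. }
set (delta := fun x y : R => proj1_sig (constructive_indefinite_description _ (hall (x, y)))).
destruct (compactness_value_2d (- r) r (- r) r delta) as [d hd].
exists d. split; [apply cond_pos|].
intros z hz.
assert (hbox : - r <= fst z <= r /\ - r <= snd z <= r).
{ pose proof (Rmax_Cmod z) as h.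
  pose proof (Rle_trans _ _ _ (Rmax_l _ _) h) as h1.
  pose proof (Rle_trans _ _ _ (Rmax_r _ _) h) as h2.
  split; apply Rabs_le_between; lra. }
specialize (hd (fst z) (snd z) (proj1 hbox) (proj2 hbox)).
apply NNPP in hd. destruct hd as (u & v & _ & _ & hu & hv & hduv).
unfold delta in hu, hv, hduv.
destruct (constructive_indefinite_description _ (hall (u, v))) as [e he]. simpl in *.
apply hmono with (2 * e); [|pose proof (cond_pos d); pose proof (cond_pos e); lra].
apply he; [exact hz|].
eapply Rle_lt_trans; [apply Cmod_2Rmax|]. simpl.
assert (hs : sqrt 2 < 2).
{ rewrite <- (sqrt_square 2) at 2 by lra. apply sqrt_lt_1; lra. }
pose proof (sqrt_pos 2).
assert (hm : Rmax (Rabs (fst z + - u)) (Rabs (snd z + - v)) < e) by (apply Rmax_lub_lt; assumption).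
assert (0 <= Rmax (Rabs (fst z + - u)) (Rabs (snd z + - v))).
{ eapply Rle_trans; [apply Rabs_pos|apply Rmax_l]. }
pose proof (cond_pos e). nra.
Qed.

(** Upper semicontinuity suffices.  If the supremum [s] were not attained,
    [u <= s - d] would hold locally, hence uniformly, against the choice of [s];
    boundedness is obtained in the same way from [u <= / d]. *)
Lemma disk_max (r : R) (u : C -> R) :
  0 <= r ->
  (forall p, Cmod p <= r -> forall e, 0 < e -> exists d, 0 < d /\
     forall z, Cmod z <= r -> Cmod (z - p) < d -> u z <= u p + e) ->
  exists p, Cmod p <= r /\ forall z, Cmod z <= r -> u z <= u p.
Proof.
intros hr husc.
assert (h0 : Cmod 0 <= r) by (rewrite Cmod_0; exact hr).
destruct (disk_uniform r (fun z d => u z <= / d)) as [d [hd hb]].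
{ intros z d d' h h'. eapply Rle_trans; [exact h|]. apply Rinv_le_contravar; lra. }
{ intros p hp. destruct (husc p hp 1 Rlt_0_1) as [d [hd h]].
  pose proof (Rabs_pos (u p)). pose proof (Rle_abs (u p)).
  assert (hi : 0 < / (Rabs (u p) + 1)) by (apply Rinv_0_lt_compat; lra).
  exists (Rmin d (/ (Rabs (u p) + 1))). split; [now apply Rmin_glb_lt|].
  intros z hz hzp.
  apply Rle_trans with (Rabs (u p) + 1).
  - assert (u z <= u p + 1); [|lra].
    apply h; [exact hz|]. eapply Rlt_le_trans; [exact hzp|apply Rmin_l].
  - rewrite <- (Rinv_inv (Rabs (u p) + 1)) at 1.
    apply Rinv_le_contravar; [now apply Rmin_glb_lt|apply Rmin_r]. }
destruct (completeness (fun y => exists z, Cmod z <= r /\ y = u z)) as [s [hub hlub]].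
{ exists (/ d). intros y (z & hz & ->). auto. }
{ exists (u 0%C), 0%C. auto. }
apply NNPP. intros hno.
assert (hlt : forall p, Cmod p <= r -> u p < s).
{ intros p hp. destruct (Rle_lt_dec s (u p)) as [h|h]; [exfalso|exact h].
  apply hno. exists p. split; [exact hp|]. intros z hz.
  apply Rle_trans with s; [|exact h]. apply hub. exists z. auto. }
destruct (disk_uniform r (fun z d => u z <= s - d)) as [e [he hb2]].
{ intros. lra. }
{ intros p hp. specialize (hlt p hp).
  destruct (husc p hp ((s - u p) / 2)) as [e [he h]]; [lra|].
  exists (Rmin e ((s - u p) / 2)). split; [apply Rmin_glb_lt; lra|].
  intros z hz hzp. pose proof (Rmin_r e ((s - u p) / 2)).
  assert (u z <= u p + (s - u p) / 2); [|lra].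
  apply h; [exact hz|]. eapply Rlt_le_trans; [exact hzp|apply Rmin_l]. }
assert (s <= s - e); [|lra].
apply hlub. intros y (z & hz & ->). auto.
Qed.

Lemma has_jet_continuous (f : C -> C) (p : C) (e : R) :
  has_jet f p -> 0 < e ->
  exists d, 0 < d /\ forall z, Cmod (z - p) < d -> Cmod (f z - f p) < e.
Proof.
intros (c0 & c1 & c2 & c3 & k & hk & h) he.
assert (hb : loc_bounded (fun t => c1 + t * (c2 + t * (c3 + t * k t)))%C) by loc_bounded.
destruct hb as [M hM].
destruct (near0_and _ _ hM h) as [d [hd hh]].
pose proof (Rabs_pos M). pose proof (Rle_abs M).
exists (Rmin d (e / (Rabs M + 1))). split.
{ apply Rmin_glb_lt; [lra|]. apply Rdiv_lt_0_compat; lra. }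
intros z hz.
destruct (hh (z - p)%C) as [h1 h2].
{ eapply Rlt_le_trans; [exact hz|apply Rmin_l]. }
assert (hz2 : Cmod (z - p) * (Rabs M + 1) < e).
{ apply Rlt_div_r; [lra|]. eapply Rlt_le_trans; [exact hz|apply Rmin_r]. }
replace (p + (z - p))%C with z in h2 by ring.
assert (hp : f p = c0).
{ pose proof (near0_at_0 _ h) as h3. cbv beta in h3. rewrite Cplus_0_r in h3. rewrite h3. ring. }
rewrite h2, hp.
match goal with |- Cmod (?a + ?b - ?a) < _ => replace (a + b - a)%C with b by ring end.
rewrite Cmod_mult. pose proof (Cmod_ge_0 (z - p)). nra.
Qed.

(** Near [p], summing [L] over the four points [p + t], [p + it], [p - t],
    [p - it] removes the terms of degree 1, 2 and 3 of the jet, so the sum differs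
    from [4 L p] by [O(|t|^4)] only; the same sum of [e * Cmod z ^ 2] exceeds its
    value at [p] by exactly [4 e |t|^2].  For small [t] one of the four points
    therefore does better than [p]. *)
Lemma no_interior_max (L : C -> C) (e r : R) (p : C) :
  0 < e -> Cmod p < r -> has_jet L p ->
  exists z, Cmod z <= r /\ Re (L p) + e * Cmod p ^ 2 < Re (L z) + e * Cmod z ^ 2.
Proof.
intros he hp (c0 & c1 & c2 & c3 & k & [M hk] & h).
destruct (near0_and _ _ hk h) as [d [hd hh]].
assert (hLp : L p = c0).
{ pose proof (near0_at_0 _ h) as h3. cbv beta in h3. rewrite Cplus_0_r in h3. rewrite h3. ring. }
pose proof (Rabs_pos M). pose proof (Rle_abs M).
set (s := Rmin (Rmin (d / 2) (r - Cmod p)) (Rmin 1 (e / (2 * (Rabs M + 1))))).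
assert (hs : 0 < s).
{ repeat apply Rmin_glb_lt; try lra. apply Rdiv_lt_0_compat; lra. }
assert (hsd : s < d).
{ apply Rle_lt_trans with (d / 2); [|lra]. eapply Rle_trans; apply Rmin_l. }
assert (hsr : s <= r - Cmod p) by (eapply Rle_trans; [apply Rmin_l|apply Rmin_r]).
assert (hs1 : s <= 1) by (eapply Rle_trans; [apply Rmin_r|apply Rmin_l]).
assert (hse : s * (2 * (Rabs M + 1)) <= e).
{ apply Rle_div_r; [lra|]. eapply Rle_trans; [apply Rmin_r|apply Rmin_r]. }
apply NNPP. intros hno.
assert (hmax : forall t, Cmod t = s ->
   Re (L (p + t)%C) + e * Cmod (p + t) ^ 2 <= Re c0 + e * Cmod p ^ 2 /\
   L (p + t)%C = (c0 + t * (c1 + t * (c2 + t * (c3 + t * k t))))%C /\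
   - M <= Re (k t)).
{ intros t ht. destruct (hh t) as [h1 h2]; [lra|]. split; [|split].
  - apply Rnot_lt_le. intros hlt. apply hno. exists (p + t)%C. rewrite hLp. split; [|exact hlt].
    eapply Rle_trans; [apply Cmod_triangle|lra].
  - exact h2.
  - pose proof (re_le_Cmod (k t)) as h3. pose proof (Rle_abs (- Re (k t))) as h4.
    rewrite Rabs_Ropp in h4. lra. }
assert (hRs : Cmod (RtoC s) = s) by (rewrite Cmod_R, Rabs_pos_eq; lra).
destruct (hmax (RtoC s) hRs) as (a1 & b1 & d1).
destruct (hmax (- RtoC s)%C) as (a2 & b2 & d2); [now rewrite Cmod_opp|].
assert (hCs : Cmod (Ci * s) = s) by (rewrite Cmod_mult, Cmod_Ci, hRs; lra).
destruct (hmax (Ci * s)%C hCs) as (a3 & b3 & d3).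
destruct (hmax (- (Ci * s))%C) as (a4 & b4 & d4); [now rewrite Cmod_opp|].
rewrite b1 in a1. rewrite b2 in a2. rewrite b3 in a3. rewrite b4 in a4.
rewrite !Cmod2_alt in a1, a2, a3, a4.
revert a1 a2 a3 a4 d1 d2 d3 d4.
generalize (k (RtoC s)) (k (- RtoC s)%C) (k (Ci * s)%C) (k (- (Ci * s))%C).
intros [k1 k1'] [k2 k2'] [k3 k3'] [k4 k4'].
destruct p as [p1 p2], c0 as [c0 c0'], c1 as [c1 c1'], c2 as [c2 c2'], c3 as [c3 c3'].
cbn [Re Im Cplus Cmult Copp Ci RtoC fst snd].
intros a1 a2 a3 a4 d1 d2 d3 d4.
assert (hsum : 4 * (e * s ^ 2) + s ^ 4 * (k1 + k2 + k3 + k4) <= 0) by (ring_simplify in a1; ring_simplify in a2; ring_simplify in a3; ring_simplify in a4; ring_simplify; lra).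
assert (hs2 : 0 < s ^ 2) by nra.
assert (hs4 : s ^ 4 <= s ^ 2 * s) by nra.
assert (s ^ 4 * (k1 + k2 + k3 + k4) >= s ^ 4 * (- (4 * M))) by nra.
nra.
Qed.

(** The perturbation [e * Cmod z ^ 2] excludes interior maxima, also for constant
    [L]; [e] is so small that the perturbed function at 0 still exceeds its values
    on the circle. *)
Lemma max_re_principle (L : C -> C) (r M : R) :
  0 < r -> (forall z, Cmod z <= r -> has_jet L z) ->
  (forall z, Cmod z = r -> Re (L z) <= M) -> Re (L 0%C) <= M.
Proof.
intros hr hL hM. apply Rnot_lt_le. intros hlt.
set (e := (Re (L 0%C) - M) / (2 * r ^ 2)).
assert (hr2 : 0 < 2 * r ^ 2) by nra.
assert (he : 0 < e) by (apply Rdiv_lt_0_compat; lra).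
set (u := fun z => Re (L z) + e * Cmod z ^ 2).
destruct (disk_max r u) as [p [hp hmax]]; [lra| |].
- intros p hp e' he'.
  destruct (has_jet_continuous L p (e' / 2) (hL p hp)) as [d [hd h]]; [lra|].
  assert (hq : 0 < e' / (4 * e * r)).
  { apply Rdiv_lt_0_compat; [lra|]. apply Rmult_lt_0_compat; lra. }
  exists (Rmin d (e' / (4 * e * r))). split; [now apply Rmin_glb_lt|].
  intros z hz hzp. unfold u.
  assert (h1 : Re (L z) - Re (L p) <= e' / 2).
  { assert (h1 : Cmod (L z - L p) < e' / 2).
    { apply h. eapply Rlt_le_trans; [exact hzp|apply Rmin_l]. }
    pose proof (re_le_Cmod (L z - L p)) as h2.
    change (Re (L z - L p)%C) with (Re (L z) - Re (L p)) in h2.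
    pose proof (Rle_abs (Re (L z) - Re (L p))). lra. }
  assert (h2 : Cmod (z - p) * (4 * e * r) < e').
  { apply Rlt_div_r; [apply Rmult_lt_0_compat; lra|].
    eapply Rlt_le_trans; [exact hzp|apply Rmin_r]. }
  assert (h3 : Cmod z <= Cmod p + Cmod (z - p)).
  { replace z with (p + (z - p))%C at 1 by ring. apply Cmod_triangle. }
  pose proof (Cmod_ge_0 z). pose proof (Cmod_ge_0 p). pose proof (Cmod_ge_0 (z - p)).
  assert (h4 : Cmod z ^ 2 - Cmod p ^ 2 <= Cmod (z - p) * (2 * r)) by nra.
  assert (e * (Cmod z ^ 2 - Cmod p ^ 2) <= e' / 2) by nra.
  lra.
- assert (h0 : u 0%C <= u p) by (apply hmax; rewrite Cmod_0; lra).
  destruct (Rle_lt_or_eq_dec _ _ hp) as [hlt'|heq].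
  + destruct (no_interior_max L e r p he hlt' (hL p hp)) as [z [hz hgt]].
    specialize (hmax z hz). unfold u in hmax. lra.
  + specialize (hM p heq). unfold u in h0. rewrite heq, Cmod_0 in h0.
    assert (e * r ^ 2 = (Re (L 0%C) - M) / 2) by (unfold e; field; lra).
    lra.
Qed.

(** * The second coefficient of a Schwarz function *)

Lemma unimodular_rotation (c : C) :
  exists u : C, (u * Cconj u = 1)%C /\ (u * c = Cmod c)%C.
Proof.
destruct (Classical_Prop.classic (c = 0%C)) as [->|hc].
- exists 1%C. split; [|rewrite Cmod_0; ring].
  apply injective_projections; simpl; ring.
- assert (hm : Cmod c <> 0) by (apply Rgt_not_eq, Cmod_gt_0, hc).
  assert (hm' : RtoC (Cmod c) <> 0%C) by (intros h; apply RtoC_inj in h; auto).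
  pose proof (Cmod2_conj c) as h. rewrite RtoC_pow in h.
  exists (Cconj c / Cmod c)%C. rewrite Cdiv_conj by exact hm'. rewrite Cconj_conj.
  replace (Cconj (Cmod c)) with (RtoC (Cmod c))
    by (apply injective_projections; simpl; ring).
  split.
  + replace (Cconj c / Cmod c * (c / Cmod c))%C with ((c * Cconj c) / Cmod c ^ 2)%C
      by (field; exact hm').
    rewrite <- h. field. exact hm'.
  + replace (Cconj c / Cmod c * c)%C with ((c * Cconj c) / Cmod c)%C by (field; exact hm').
    rewrite <- h. field. exact hm'.
Qed.

(** [K] is [w / z^2] with its simple pole [c1 / z] removed.  Near 0 it is the
    twice shifted power series of [w]. *)
Lemma has_jet_quotient (w : C -> C) (c1 c2 c3 : C) :
  analytic w -> jet w 0 c1 c2 c3 ->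
  exists K : C -> C,
    K 0%C = c2 /\
    (forall z : C, z <> 0%C -> K z = w z * (/ z * / z) + - c1 * / z)%C /\
    (forall z, in_disk z -> has_jet K z).
Proof.
intros hw hj.
set (K := fun z : C => if excluded_middle_informative (z = 0%C) then c2
          else (w z * (/ z * / z) + - c1 * / z)%C).
exists K. split; [|split].
{ unfold K. destruct (excluded_middle_informative (RtoC 0 = RtoC 0)) as [_|h]; [reflexivity|now destruct h]. }
{ intros z hz. unfold K. destruct (excluded_middle_informative (z = 0%C)); [contradiction|reflexivity]. }
intros z hz.
destruct (excluded_middle_informative (z = 0%C)) as [hz0|hz0].
- rewrite hz0 in *. clear hz0 z.
  destruct (hw 0%C hz) as (r & a & hr & ha).
  assert (ha' : forall z, Cmod z < r -> C_pseries a z (w z)).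
  { intros z h. specialize (ha z). replace (z - 0)%C with z in ha by ring. auto. }
  destruct (jet_unique _ _ _ _ _ _ _ _ _ hj (jet_C_pseries a w r hr ha'))
    as (e0 & e1 & e2 & _).
  destruct (C_pseries_shift _ _ _ ha') as [w1 [h1 d0]].
  destruct (C_pseries_shift _ _ _ h1) as [w2 [h2 d1]].
  exists (a 2%nat), (a 3%nat), (a 4%nat), (a 5%nat).
  apply jet_near with w2.
  2: exact (jet_C_pseries _ _ r hr h2).
  exists r. split; [exact hr|]. intros t ht. rewrite Cplus_0_l. unfold K.
  destruct (excluded_middle_informative (t = 0%C)) as [ht0|ht0].
  + rewrite ht0 in *. rewrite (C_pseries_at_0 _ _ (h2 _ ht)). exact e2.
  + rewrite (d0 t ht), (d1 t ht), <- e0, <- e1. field. exact ht0.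
- apply has_jet_near with (fun z : C => w z * (/ z * / z) + - c1 * / z)%C.
  + exists (Cmod z). split; [now apply Cmod_gt_0|]. intros t ht. unfold K.
    destruct (excluded_middle_informative (z + t = 0)%C) as [h|_]; [exfalso|reflexivity].
    assert (hzt : z = (- t)%C) by (replace z with (z + t - t)%C by ring; rewrite h; ring).
    rewrite hzt, Cmod_opp in ht. lra.
  + pose proof (has_jet_inv z hz0) as hi.
    apply (has_jet_plus (fun z : C => w z * (/ z * / z))%C (fun z : C => - c1 * / z)%C).
    * apply (has_jet_mult w (fun z : C => / z * / z)%C).
      -- apply analytic_at_jet, hw, hz.
      -- now apply (has_jet_mult (fun z : C => / z)%C (fun z : C => / z)%C).
    * apply (has_jet_mult (fun _ => - c1)%C (fun z : C => / z)%C); [apply has_jet_const|exact hi].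
Qed.

(** Put [q = 1 + kap z].  On the circle [/ Cconj z = z / r^2], so [u c1 / z] and
    [kap z / r^2] are conjugate to each other, and the non-analytic [|q|^2] of the bound
    [Re (u w q^2 / z^2) <= |q|^2 / r^2] equals [1 + |c1|^2 r^2] plus twice the
    real part of [kap z].  The linear terms cancel and a constant remains. *)
Lemma circle_estimate (w z c1 u : C) (r : R) :
  0 < r -> Cmod z = r -> Cmod w < 1 -> (u * Cconj u = 1)%C ->
  let kap := (Cconj c1 * Cconj u)%C in
  Re (2 * (c1 * Cconj c1) + c1 * Cconj c1 * kap * z
      + u * (w * (/ z * / z) + - c1 * / z) * ((1 + kap * z) * (1 + kap * z))
      + - kap * / (r ^ 2) * z)%C <= / r ^ 2 + Cmod c1 ^ 2.
Proof.
intros hr hz hw hu kap.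
assert (hz0 : z <> 0%C) by (apply Cmod_gt_0; lra).
assert (hr0 : RtoC r <> 0%C) by (intros h; apply RtoC_inj in h; lra).
assert (hzz : (z * Cconj z = RtoC r ^ 2)%C).
{ rewrite <- Cmod2_conj, hz. now rewrite RtoC_pow. }
assert (hcz0 : Cconj z <> 0%C).
{ intros h. rewrite h, Cmult_0_r in hzz. apply (Cpow_nz _ 2) in hr0. auto. }
assert (huc : (u * c1 * kap = c1 * Cconj c1)%C).
{ unfold kap. transitivity ((u * Cconj u) * (c1 * Cconj c1))%C; [ring|rewrite hu; ring]. }
assert (hucz : Cconj (u * c1 * / z)%C = (kap * / (r ^ 2) * z)%C).
{ rewrite !Cmult_conj, Cinv_conj by exact hz0. rewrite <- hzz. unfold kap. field. auto. }
set (q := (1 + kap * z)%C).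
match goal with |- Re ?X <= _ =>
  replace X with (u * w * (q * q) * (/ z * / z) + - (u * c1 * / z) + - (kap * / (r ^ 2) * z))%C end.
2:{ rewrite <- huc. unfold q. field. auto. }
assert (hsplit : forall x y v : C, Re (x + - y + - v)%C = Re x - Re y - Re v).
{ intros x y v. unfold Re; simpl. ring. }
rewrite hsplit, <- (re_conj (u * c1 * / z)%C), hucz.
assert (hum : Cmod u = 1).
{ assert (h : RtoC (Cmod u ^ 2) = 1%C) by (rewrite Cmod2_conj; exact hu).
  apply RtoC_inj in h. pose proof (Cmod_ge_0 u). nra. }
assert (hk : Cmod kap = Cmod c1).
{ unfold kap. rewrite Cmod_mult, !Cmod_conj, hum. ring. }
assert (hre : Re (u * w * (q * q) * (/ z * / z))%C <= Cmod q ^ 2 * / r ^ 2).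
{ eapply Rle_trans; [apply Rle_abs|]. eapply Rle_trans; [apply re_le_Cmod|].
  rewrite !Cmod_mult, Cmod_inv, hum, hz by exact hz0.
  replace (/ r ^ 2) with (/ r * / r) by (field; lra).
  pose proof (Cmod_ge_0 w).
  assert (0 <= Cmod q * Cmod q * (/ r * / r)).
  { assert (0 < / r) by (apply Rinv_0_lt_compat; lra). pose proof (Cmod_ge_0 q).
    apply Rmult_le_pos; nra. }
  nra. }
assert (hq : Cmod q ^ 2 = 1 + 2 * Re (kap * z)%C + Cmod c1 ^ 2 * r ^ 2).
{ rewrite <- hk, <- hz, <- Rpow_mult_distr, <- Cmod_mult, !Cmod2_alt. unfold q.
  destruct (kap * z)%C as [x y]. unfold Re, Im; simpl. ring. }
assert (hlin : Re (kap * / r ^ 2 * z)%C = Re (kap * z)%C * / r ^ 2).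
{ replace (kap * / r ^ 2 * z)%C with (kap * z * / r ^ 2)%C by ring.
  rewrite <- RtoC_pow, <- RtoC_inv by nra.
  destruct (kap * z)%C as [x y]. unfold Re; simpl. ring. }
rewrite hlin. rewrite hq in hre.
assert (hrr : (1 + 2 * Re (kap * z)%C + Cmod c1 ^ 2 * r ^ 2) * / r ^ 2
   = / r ^ 2 + 2 * (Re (kap * z)%C * / r ^ 2) + Cmod c1 ^ 2) by (field; lra).
lra.
Qed.

(** Schwarz-Pick inequality in coefficient form: the test function of
    [circle_estimate] takes the value [2 |c1|^2 + |c2|] at 0. *)
Lemma second_coeff_bound (w : C -> C) (c1 c2 c3 : C) :
  analytic w -> (forall z, in_disk z -> in_disk (w z)) -> jet w 0 c1 c2 c3 ->
  Cmod c2 <= 1 - Cmod c1 ^ 2.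
Proof.
intros hw hdisk hj.
destruct (has_jet_quotient w c1 c2 c3 hw hj) as (K & hK0 & hK & hKj).
destruct (unimodular_rotation c2) as (u & hu & huc2).
set (kap := (Cconj c1 * Cconj u)%C).
assert (hmain : forall r, 0 < r < 1 -> Cmod c2 + Cmod c1 ^ 2 <= / r ^ 2).
{ intros r hr.
  set (L := fun z : C => (2 * (c1 * Cconj c1) + c1 * Cconj c1 * kap * z
      + u * K z * ((1 + kap * z) * (1 + kap * z)) + - kap * / (r ^ 2) * z)%C).
  assert (h : Re (L 0%C) <= / r ^ 2 + Cmod c1 ^ 2).
  { apply max_re_principle with r; [lra| |].
    - intros z hz. assert (hd : in_disk z) by (unfold in_disk; lra). unfold L.
      repeat first [ apply has_jet_const | apply has_jet_id | now apply hKj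
        | apply (has_jet_plus (fun z => _) (fun z => _))
        | apply (has_jet_mult (fun z => _) (fun z => _)) ].
    - intros z hz. unfold L. rewrite hK.
      + apply circle_estimate; auto; [lra|]. apply hdisk. unfold in_disk; lra.
      + apply Cmod_gt_0; lra. }
  unfold L in h. rewrite hK0 in h.
  replace (2 * (c1 * Cconj c1) + c1 * Cconj c1 * kap * 0 +
      u * c2 * ((1 + kap * 0) * (1 + kap * 0)) + - kap * / r ^ 2 * 0)%C
    with (RtoC (2 * Cmod c1 ^ 2 + Cmod c2)) in h.
  - simpl Re in h. unfold RtoC, Re in h. cbn [fst] in h. lra.
  - rewrite RtoC_plus, RtoC_mult, Cmod2_conj, <- huc2. ring. }
apply Rnot_lt_le. intros hlt.
set (s := Cmod c2 + Cmod c1 ^ 2) in *.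
assert (hs : 1 < s) by (unfold s; lra).
assert (hi : 0 < / s < 1).
{ split; [apply Rinv_0_lt_compat; lra|]. rewrite <- Rinv_1. apply Rinv_lt_contravar; lra. }
(* [r] is the mean of 1 and [/ s], so that [r ^ 2 > / s]. *)
set (r := (1 + / s) / 2).
assert (hr : 0 < r < 1) by (unfold r; lra).
assert (h1 : / s < r ^ 2) by (unfold r; nra).
specialize (hmain r hr).
assert (/ r ^ 2 < s); [|lra].
rewrite <- (Rinv_inv s). apply Rinv_lt_contravar; [|exact h1].
apply Rmult_lt_0_compat; lra.
Qed.

(** * Coefficients of bi-convex functions *)

(** [1 / f'] is the jet of the inverse at 1 composed with the jet of [f' - 1]. *)
Lemma jet_convexity_quotient (f : C -> C) (a : nat -> C) (r : R) :
  0 < r -> (forall z, Cmod z < r -> C_pseries a z (f z)) -> a 1%nat = 1%C ->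
  exists e3, jet (convexity_quotient f) 1 (2 * a 2%nat)
    (6 * a 3%nat - 4 * (a 2%nat * a 2%nat)) e3.
Proof.
intros hr hf ha1.
pose proof (C_pseries_derive _ _ _ hf) as hf1.
pose proof (C_pseries_derive _ _ _ hf1) as hf2.
pose proof (jet_C_pseries _ _ _ hr hf1) as j1.
pose proof (jet_C_pseries _ _ _ hr hf2) as j2.
unfold C_PS_derive in j1, j2. rewrite ha1 in j1.
rewrite !INR_IZR_INZ in j1, j2. cbn [Z.of_nat Pos.of_succ_nat Pos.succ] in j1, j2.
assert (j1' : jet (fun z => C_derive f z + - (1))%C
  0 (2 * a 2%nat) (3 * a 3%nat) (4 * a 4%nat)).
{ pose proof (jet_plus _ _ _ _ _ _ _ _ _ _ j1 (jet_const (- (1)))) as h.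
  rewrite !Cplus_0_r in h.
  replace (1 * 1 + - (1))%C with (RtoC 0) in h by ring. exact h. }
assert (h1 : (1%C : C) <> 0%C) by (intros h; apply RtoC_inj in h; lra).
pose proof (jet_comp0 _ _ _ _ _ _ _ _ _ (jet_inv 1%C h1) j1') as ji. cbv beta in ji.
pose proof (jet_plus _ _ _ _ _ _ _ _ _ _ (jet_const 1)
  (jet_mult _ _ _ _ _ _ _ _ _ _ (jet_mult _ _ _ _ _ _ _ _ _ _ jet_id j2) ji)) as h.
cbv beta in h.
eexists. apply jet_ext with (h := fun t : C =>
  (1 + t * C_derive (C_derive f) t * / (1 + (C_derive f t + - (1))))%C).
{ intros t. unfold convexity_quotient, Cdiv. do 3 f_equal. ring. }
match type of h with jet _ ?u0 ?u1 ?u2 _ =>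
  replace u0 with (RtoC 1) in h by ring;
  replace u1 with (2 * a 2%nat)%C in h by field;
  replace u2 with (6 * a 3%nat - 4 * (a 2%nat * a 2%nat))%C in h
end.
- exact h.
- field.
Qed.

Lemma subordinate_coefficients (F phi : C -> C) (B : nat -> C) (e0 e1 e2 e3 : C) :
  taylor phi B -> subordinate F phi -> jet F e0 e1 e2 e3 ->
  exists c1 c2 : C, e1 = (B 1%nat * c1)%C /\ e2 = (B 1%nat * c2 + B 2%nat * c1 * c1)%C /\
    Cmod c2 <= 1 - Cmod c1 ^ 2.
Proof.
intros hB (_ & _ & w & hw & hdisk & hw0 & hF) hj.
assert (h0 : in_disk 0%C) by (unfold in_disk; rewrite Cmod_0; lra).
destruct (analytic_at_jet w 0%C (hw _ h0)) as (c0 & c1 & c2 & c3 & hc).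
apply (jet_ext w) in hc; [|intros t; now rewrite Cplus_0_l].
pose proof (jet_at_0 _ _ _ _ _ hc) as e. rewrite hw0 in e. rewrite <- e in hc. clear e c0.
pose proof (jet_comp0 _ _ _ _ _ _ _ _ _ (jet_C_pseries B phi 1 Rlt_0_1 hB) hc) as hcomp.
apply (jet_near F) in hcomp.
2:{ exists 1. split; [lra|]. exact hF. }
destruct (jet_unique _ _ _ _ _ _ _ _ _ hj hcomp) as (_ & d1 & d2 & _).
exists c1, c2. split; [exact d1|]. split; [exact d2|].
exact (second_coeff_bound w c1 c2 c3 hw hdisk hc).
Qed.

Lemma inverse_coefficients (f g : C -> C) (a2 a3 b1 b2 b3 : C) :
  jet f 0 1 a2 a3 -> jet g 0 b1 b2 b3 -> near0 (fun w => f (g w) = w) ->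
  b1 = 1%C /\ b2 = (- a2)%C /\ b3 = (2 * a2 * a2 - a3)%C.
Proof.
intros hf hg hfg.
pose proof (jet_comp0 _ _ _ _ _ _ _ _ _ hf hg) as h.
destruct (jet_unique _ _ _ _ _ _ _ _ _ h (jet_near _ _ _ _ _ _ hfg jet_id))
  as (_ & e1 & e2 & e3).
rewrite Cmult_1_l in e1. rewrite e1 in e2, e3.
assert (hb2 : b2 = (- a2)%C).
{ transitivity (1 * b2 + a2 * 1 * 1 - a2)%C; [ring|rewrite e2; ring]. }
split; [exact e1|]. split; [exact hb2|].
rewrite hb2 in e3.
transitivity (1 * b3 + 2 * a2 * 1 * - a2 + a3 * 1 * 1 * 1 + 2 * a2 * a2 - a3)%C;
  [ring|rewrite e3; ring].
Qed.

(** Bound for [a2]: since [4 |a2|^2 = b^2 |c1|^2], the estimates of [c2] and [d2]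
    give [|4 b^2 - 8 B2| |a2|^2 <= 2 b^3 - 8 b |a2|^2]; moving the last term to the
    left makes the modulus of [4 (b^2 + 2 b - 2 B2)] appear by the triangle
    inequality.  Bound for [a3]: it is at most half the convex combination of [b]
    and [|B2|] with weights [1 - |c1|^2] and [|c1|^2], and
    [|B2| <= b + |B2 - b|]. *)
Lemma coefficient_bounds (b : R) (B2 a2 a3 c1 c2 d1 d2 : C) :
  0 < b ->
  (2 * a2 = b * c1)%C -> (6 * a3 - 4 * (a2 * a2) = b * c2 + B2 * c1 * c1)%C ->
  (2 * - a2 = b * d1)%C ->
  (6 * (2 * a2 * a2 - a3) - 4 * (- a2 * - a2) = b * d2 + B2 * d1 * d1)%C ->
  Cmod c2 <= 1 - Cmod c1 ^ 2 -> Cmod d2 <= 1 - Cmod d1 ^ 2 ->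
  2 * Cmod (b ^ 2 + 2 * b - 2 * B2)%C * Cmod a2 ^ 2 <= b ^ 3 /\
  Cmod a3 <= 1 / 2 * (b + Cmod (B2 - b)%C).
Proof.
intros hb e1 e2 e3 e4 hc2 hd2.
assert (hb0 : RtoC b <> 0%C) by (intros h; apply RtoC_inj in h; lra).
assert (hd1 : d1 = (- c1)%C).
{ replace d1 with (b * d1 / b)%C by (field; exact hb0). rewrite <- e3.
  replace (2 * - a2)%C with (- (2 * a2))%C by ring. rewrite e1. field. exact hb0. }
rewrite hd1 in *. rewrite Cmod_opp in hd2.
assert (hmod : Cmod (RtoC b) = b) by (rewrite Cmod_R, Rabs_pos_eq; lra).
assert (hmod2 : forall x, 0 <= x -> Cmod (RtoC x) = x) by (intros; rewrite Cmod_R, Rabs_pos_eq; lra).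
pose proof (Cmod_ge_0 c1) as p1. pose proof (Cmod_ge_0 c2) as p2.
pose proof (Cmod_ge_0 d2) as p3. pose proof (Cmod_ge_0 a2) as p4.
split.
- assert (hc1 : 2 * Cmod a2 = b * Cmod c1).
  { rewrite <- hmod at 1. rewrite <- Cmod_mult, <- e1, Cmod_mult, hmod2; lra. }
  (* The sum of the second and the fourth relation, times [b ^ 2]: there
     [b ^ 2 * c1 ^ 2] is replaced by [4 * a2 ^ 2]. *)
  assert (key : ((4 * b ^ 2 - 8 * B2) * (a2 * a2) = b ^ 3 * (c2 + d2))%C).
  { transitivity (b ^ 2 * ((6 * a3 - 4 * (a2 * a2)) + (6 * (2 * a2 * a2 - a3) - 4 * (- a2 * - a2)))
      - 2 * B2 * (2 * a2) * (2 * a2))%C; [ring|].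
    rewrite e2, e4, e1. ring. }
  apply (f_equal Cmod) in key.
  rewrite !Cmod_mult, Cmod_pow, hmod in key.
  pose proof (Cmod_triangle c2 d2) as ht.
  assert (hA : 4 * Cmod (b ^ 2 + 2 * b - 2 * B2)%C <= Cmod (4 * b ^ 2 - 8 * B2)%C + 8 * b).
  { replace (8 * b) with (Cmod (RtoC (8 * b))) by (apply hmod2; lra).
    replace (4 * Cmod (b ^ 2 + 2 * b - 2 * B2)%C)
      with (Cmod (4 * (b ^ 2 + 2 * b - 2 * B2))%C)
      by (rewrite Cmod_mult, hmod2 by lra; reflexivity).
    replace (4 * (b ^ 2 + 2 * b - 2 * B2))%C with (4 * b ^ 2 - 8 * B2 + RtoC (8 * b))%C
      by (rewrite RtoC_mult; ring).
    apply Cmod_triangle. }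
  set (N := Cmod (b ^ 2 + 2 * b - 2 * B2)%C) in *.
  set (D := Cmod (4 * b ^ 2 - 8 * B2)%C) in *.
  assert (h3 : 0 < b ^ 3) by (apply pow_lt; exact hb).
  assert (h4 : D * (Cmod a2 * Cmod a2) <= b ^ 3 * (2 - 2 * Cmod c1 ^ 2)).
  { rewrite key. apply Rmult_le_compat_l; lra. }
  assert (h5 : b ^ 3 * Cmod c1 ^ 2 = 4 * b * Cmod a2 ^ 2).
  { replace (b ^ 3 * Cmod c1 ^ 2) with (b * (b * Cmod c1) ^ 2) by ring. rewrite <- hc1. ring. }
  pose proof (Rmult_le_compat_r (Cmod a2 ^ 2) _ _ (pow2_ge_0 _) hA) as h6.
  simpl in h4, h5, h6 |- *. lra.
- (* Twice the second relation plus the fourth: the terms in [a2] cancel. *)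
  assert (key : (6 * a3 = b * (2 * c2 + d2) + 3 * (B2 * (c1 * c1)))%C).
  { transitivity (2 * (6 * a3 - 4 * (a2 * a2)) + (6 * (2 * a2 * a2 - a3) - 4 * (- a2 * - a2)))%C;
      [ring|]. rewrite e2, e4. ring. }
  assert (h6 : 6 * Cmod a3 <= b * (2 * Cmod c2 + Cmod d2) + 3 * (Cmod B2 * (Cmod c1 * Cmod c1))).
  { replace (6 * Cmod a3) with (Cmod (6 * a3)%C)
      by (rewrite Cmod_mult, hmod2 by lra; reflexivity).
    rewrite key.
    eapply Rle_trans; [apply Cmod_triangle|].
    rewrite !Cmod_mult, hmod, (hmod2 3) by lra. apply Rplus_le_compat_r.
    apply Rmult_le_compat_l; [lra|]. eapply Rle_trans; [apply Cmod_triangle|].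
    rewrite Cmod_mult, (hmod2 2) by lra. lra. }
  assert (hB : Cmod B2 <= b + Cmod (B2 - b)%C).
  { rewrite <- hmod at 1. replace B2 with (b + (B2 - b))%C at 1 by ring. apply Cmod_triangle. }
  pose proof (Cmod_ge_0 (B2 - b)%C). pose proof (Cmod_ge_0 B2).
  assert (h1 : 0 <= Cmod c1 * Cmod c1 <= 1) by nra.
  set (x := Cmod c1 * Cmod c1) in *.
  assert (h7 : b * (2 * Cmod c2 + Cmod d2) <= 3 * (b * (1 - x))).
  { replace (3 * (b * (1 - x))) with (b * (3 * (1 - x))) by ring.
    apply Rmult_le_compat_l; [lra|]. unfold x. simpl in hc2, hd2. lra. }
  assert (h8 : Cmod B2 * x <= (b + Cmod (B2 - b)) * x) by (apply Rmult_le_compat_r; lra).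
  nra.
Qed.

Lemma CV_sigma_coefficient_relations (phi f : C -> C) (B a : nat -> C) :
  taylor phi B -> taylor f a -> class_CV_sigma phi f ->
  exists c1 c2 d1 d2 : C,
    (2 * a 2%nat = B 1%nat * c1)%C /\
    (6 * a 3%nat - 4 * (a 2%nat * a 2%nat) = B 1%nat * c2 + B 2%nat * c1 * c1)%C /\
    (2 * - a 2%nat = B 1%nat * d1)%C /\
    (6 * (2 * a 2%nat * a 2%nat - a 3%nat) - 4 * (- a 2%nat * - a 2%nat)
       = B 1%nat * d2 + B 2%nat * d1 * d1)%C /\
    Cmod c2 <= 1 - Cmod c1 ^ 2 /\ Cmod d2 <= 1 - Cmod d1 ^ 2.
Proof.
intros hB ha (g & ((_ & hf0 & hf1) & (_ & hinj) & (hg & _) & (r & hr & hfg)) & hsf & hsg).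
assert (h0 : in_disk 0%C) by (unfold in_disk; rewrite Cmod_0; lra).
assert (hz : Cmod 0 < r) by (rewrite Cmod_0; exact hr).
(* [local_inverse] gives [f (g 0) = 0]; injectivity of [f] on the disk concludes. *)
assert (hg0 : g 0%C = 0%C).
{ destruct (hfg 0%C hz) as [h1 h2]. apply hinj; auto. now rewrite h2, hf0. }
assert (ha0 : a 0%nat = 0%C).
{ rewrite <- (C_pseries_at_0 _ _ (ha _ h0)). exact hf0. }
assert (ha1 : a 1%nat = 1%C).
{ pose proof (C_pseries_at_0 _ _ (C_pseries_derive a f 1 ha 0%C h0)) as h.
  rewrite hf1 in h. unfold C_PS_derive in h. rewrite h. simpl. ring. }
destruct (hg 0%C h0) as (s & b & hs & hb').
assert (hb : forall z, Cmod z < s -> C_pseries b z (g z)).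
{ intros z h. specialize (hb' z). replace (z - 0)%C with z in hb' by ring. auto. }
pose proof (jet_C_pseries a f 1 Rlt_0_1 ha) as jf. rewrite ha0, ha1 in jf.
pose proof (jet_C_pseries b g s hs hb) as jg.
rewrite <- (jet_at_0 _ _ _ _ _ jg), hg0 in jg.
destruct (inverse_coefficients f g _ _ _ _ _ jf jg) as (hb1 & hb2 & hb3).
{ exists r. split; [exact hr|]. intros w hw. now apply hfg. }
destruct (jet_convexity_quotient f a 1 Rlt_0_1 ha ha1) as [e3 hqf].
destruct (jet_convexity_quotient g b s hs hb hb1) as [e3' hqg].
destruct (subordinate_coefficients _ _ _ _ _ _ _ hB hsf hqf) as (c1 & c2 & hc).
destruct (subordinate_coefficients _ _ _ _ _ _ _ hB hsg hqg) as (d1 & d2 & hd).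
rewrite hb2, hb3 in hd.
exists c1, c2, d1, d2. tauto.
Qed.

Theorem corollary2p2 (phi f : C -> C) (B a : nat -> C)
  (hphi : analytic phi)
  (hphi_re : forall z : C, in_disk z -> 0 < Re (phi z))
  (hphi0 : phi 0%C = 1%C)
  (hphi' : Im (C_derive phi 0%C) = 0 /\ 0 < Re (C_derive phi 0%C))
  (hphi_sym : image_symmetric phi)
  (hB : taylor phi B)
  (ha : taylor f a)
  (hf : class_CV_sigma phi f) :
  ((B 1%nat ^ 2 + 2 * B 1%nat - 2 * B 2%nat)%C <> 0%C ->
     Cmod (a 2%nat) <=
       Re (B 1%nat) * sqrt (Re (B 1%nat)) /
       sqrt (2 * Cmod (B 1%nat ^ 2 + 2 * B 1%nat - 2 * B 2%nat)%C))
  /\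
  Cmod (a 3%nat) <= 1 / 2 * (Re (B 1%nat) + Cmod (B 2%nat - B 1%nat)%C).
Proof.
assert (h0 : in_disk 0%C) by (unfold in_disk; rewrite Cmod_0; lra).
assert (hB1 : C_derive phi 0%C = B 1%nat).
{ rewrite (C_pseries_at_0 _ _ (C_pseries_derive B phi 1 hB 0%C h0)).
  unfold C_PS_derive. simpl. ring. }
rewrite hB1 in hphi'. destruct hphi' as [him hre].
destruct (CV_sigma_coefficient_relations phi f B a hB ha hf)
  as (c1 & c2 & d1 & d2 & e1 & e2 & e3 & e4 & hc & hd).
assert (hb : B 1%nat = RtoC (Re (B 1%nat))).
{ apply injective_projections; [reflexivity|exact him]. }
set (b := Re (B 1%nat)) in *. rewrite hb in *.
destruct (coefficient_bounds b _ _ _ _ _ _ _ hre e1 e2 e3 e4 hc hd) as [h2 h3].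
split; [|exact h3].
intros hA. apply Cmod_gt_0 in hA.
set (N := Cmod (b ^ 2 + 2 * b - 2 * B 2%nat)%C) in *.
assert (hN : 0 < 2 * N) by lra.
apply Rle_div_r; [now apply sqrt_lt_R0|].
apply Rsqr_incr_0_var.
- rewrite !Rsqr_mult, !Rsqr_sqrt by lra. unfold Rsqr. simpl in h2. lra.
- apply Rmult_le_pos; [lra|apply sqrt_pos].
Qed.
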